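(* Let $v$ be a Llull matrix on a finite set $A$, and let $A$ be partitioned in two sets $X$ and $Y$ with the property that $v_{xy}>1/2$ whenever $x\in X$ and $y\in Y$. Then the rank-like rates satisfy $r_x<r_y$ for any $x\in X$ and $y\in Y$.
   Context: Let $A$ be a finite set with $N$ elements and $\Pi$ the set of ordered pairs $xy$ with $x,y\in A$, $x\ne y$. A relation on $A$ is a subset of $\Pi$. A Llull matrix on $A$ is a family $v=(v_{xy})_{xy\in\Pi}$ with $v_{xy}\in[0,1]$ and $v_{xy}+v_{yx}\le1$. Turnovers: $t_{xy}=v_{xy}+v_{yx}$. Indirect scores: $v^*_{xy}=\max\min_{0\le i<n}v_{x_ix_{i+1}}$, the max being over all paths $x_0x_1\dots x_n$ ($n\ge1$, consecutive elements distinct) with $x_0=x$, $x_n=y$. Put $m^\nu_{xy}=v^*_{xy}-v^*_{yx}$, $\nu=\{xy\in\Pi: m^\nu_{xy}>0\}$, $\hat\nu=\{xy\in\Pi: m^\nu_{xy}\ge0\}$. An admissible order is a (strict) total order $\xi\subseteq\Pi$ with $\nu\subseteq\xi\subseteq\hat\nu$; one always exists. Write $x\succ y$ for $xy\in\xi$, $x\succeq y$ for $x\succ y$ or $x=y$, and $x'$ for the immediate successor of $x$ in $\xi$ (for $x$ not last). Given an admissible order $\xi$, the projected scores are obtained as follows. (i) For $x\succ y$: $m^\sigma_{xy}=\min\{m^\nu_{pq}: p\succeq x,\ y\succeq q\}$. (ii) $(t^\sigma_{xy})_{xy\in\Pi}$ is the unique minimizer of $\sum_{xy\in\Pi}(\tau_{xy}-t_{xy})^2$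 among all real families $(\tau_{xy})_{xy\in\Pi}$ such that $\tau_{xy}=\tau_{yx}$ for all $xy$; $m^\sigma_{xx'}\le\tau_{xx'}\le1$ for all non-last $x$; $0\le\tau_{xy}-\tau_{xy'}\le m^\sigma_{yy'}$ for all non-last $y$ and all $x\notin\{y,y'\}$. (iii) $\gamma_{xx'}=[(t^\sigma_{xx'}-m^\sigma_{xx'})/2,\ (t^\sigma_{xx'}+m^\sigma_{xx'})/2]$, and for $x\succ y$, $\gamma_{xy}=\bigcup\{\gamma_{pp'}: x\succeq p\succ y\}$, which is a closed interval. (iv) For $x\succ y$: $v^\pi_{xy}=\max\gamma_{xy}$, $v^\pi_{yx}=\min\gamma_{xy}$. The projected scores do not depend on the choice of $\xi$. Rank-like rates: $r_x=N-\sum_{y\ne x}v^\pi_{xy}$. *)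

(* Defs.v *)
From HB Require Import structures.
From mathcomp Require Import all_boot all_order all_algebra.
From mathcomp Require Import all_classical all_reals.
Set Implicit Arguments.
Unset Strict Implicit.
Unset Printing Implicit Defensive.
Import Order.TTheory GRing.Theory Num.Theory.
Local Open Scope classical_set_scope.
Local Open Scope ring_scope.

(* A family indexed by the ordered pairs xy with x <> y is a function
   A -> A -> R whose diagonal values are never constrained nor used. *)

Section Llull.
Context {R : realType} {A : finType}.
Implicit Types (v tau : A -> A -> R) (xi : rel A) (x y : A) (p : seq A).

Definition llull_matrix v : Prop :=
  forall x y, x != y -> 0 <= v x y <= 1 /\ v x y + v y x <= 1.

Definition turnover v x y : R := v x y + v y x.

(* x :: p is a path x_0 x_1 ... x_n with n >= 1 from x to y. *)
Definition is_path x y p : bool :=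
  [&& p != [::], path (fun a b => a != b) x p & last x p == y].

(* min of the v x_i x_(i+1); the initial value 1 is harmless as all the scores
   of a Llull matrix are at most 1. *)
Definition path_score v x p : R := \big[Num.min/1]_(s <- pairmap v x p) s.

(* The set of path scores is finite (each is 1 or some v a b), so for x <> y
   its supremum is a maximum. *)
Definition indirect_score v x y : R :=
  sup [set path_score v x p | p in [set p | is_path x y p]].

Definition mnu v x y : R := indirect_score v x y - indirect_score v y x.

Definition nu v : rel A := [rel x y | (x != y) && (0 < mnu v x y)].

Definition nuhat v : rel A := [rel x y | (x != y) && (0 <= mnu v x y)].

Definition strict_total_order xi : Prop :=
  [/\ irreflexive xi, transitive xi & forall x y, x != y -> xi x y || xi y x].

Definition admissible v xi : Prop :=
  [/\ strict_total_order xi, subrel (nu v) xi & subrel xi (nuhat v)].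

(* xi x y reads "x precedes y"; preceq is its reflexive closure. *)
Definition preceq xi x y : bool := (x == y) || xi x y.

(* isucc xi x y : y is the immediate successor x' of x; in particular x is not
   the last element. *)
Definition isucc xi x y : bool := xi x y && [forall z, ~~ (xi x z && xi z y)].

(* Meaningful for xi x y; the initial value is the term (p, q) = (x, y). *)
Definition msigma v xi x y : R :=
  \big[Num.min/mnu v x y]_(pq : A * A | preceq xi pq.1 x && preceq xi y pq.2)
    mnu v pq.1 pq.2.

Definition feasible_turnovers v xi tau : Prop :=
  [/\ forall x y, x != y -> tau x y = tau y x,
      forall x x', isucc xi x x' -> msigma v xi x x' <= tau x x' <= 1
    & forall x y y', isucc xi y y' -> x != y -> x != y' ->
        0 <= tau x y - tau x y' <= msigma v xi y y'].

Definition turnover_dist v tau : R :=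
  \sum_(xy : A * A | xy.1 != xy.2)
    (tau xy.1 xy.2 - turnover v xy.1 xy.2) ^+ 2.

(* The off-diagonal part of such a tau is unique. *)
Definition projected_turnovers v xi tau : Prop :=
  feasible_turnovers v xi tau /\
  forall tau', feasible_turnovers v xi tau' ->
    turnover_dist v tau <= turnover_dist v tau'.

Definition gamma_succ v xi tau x x' : set R :=
  [set s | (tau x x' - msigma v xi x x') / 2 <= s
           <= (tau x x' + msigma v xi x x') / 2].

Definition gamma v xi tau x y : set R :=
  \bigcup_(pq in [set pq : A * A |
                   [&& isucc xi pq.1 pq.2, preceq xi x pq.1 & xi pq.1 y]])
    gamma_succ v xi tau pq.1 pq.2.

(* gamma is a nonempty finite union of closed bounded intervals, so that sup and
   inf are its maximum and minimum. *)
Definition projected_score v xi tau x y : R :=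
  if xi x y then sup (gamma v xi tau x y) else inf (gamma v xi tau y x).

Definition rank_rate v xi tau x : R :=
  #|A|%:R - \sum_(y | y != x) projected_score v xi tau x y.

End Llull.

(* Main.v *)
Require Import Defs.
From mathcomp Require Import all_boot all_order all_algebra.
From mathcomp Require Import all_classical all_reals.
From mathcomp Require Import lra.
Set Implicit Arguments.
Unset Strict Implicit.
Unset Printing Implicit Defensive.
Import Order.TTheory GRing.Theory Num.Theory.
Local Open Scope ring_scope.

(** Every path from [Y] to [X] crosses an edge of score at most 1/2, so all of
    [X] precedes all of [Y] in the admissible order, with positive margins of
    indirect scores.  The projected scores satisfy [v^pi_xz >= v^pi_yz] whenever
    [x] precedes [y], which already gives [r_x <= r_y].  The inequality is strict
    because the interval [gamma_xy] contains [gamma_ab], where [a] is the last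
    element of [X] and [b] the first of [Y]; its length [m^sigma_ab] is a minimum
    of margins from [X] to [Y], hence positive, and so [v^pi_xy > v^pi_yx]. *)


(** * Extremal elements and neighbours in a finite strict total order *)

Section StrictTotalOrder.
Context {A : finType}.
Implicit Types (xi : rel A) (x y z : A).

Lemma xi_neq xi : strict_total_order xi -> forall x y, xi x y -> x != y.
Proof. by move=> [irr _ _] x y; apply: contraTneq => ->; rewrite irr. Qed.

Lemma strict_total_order_converse xi :
  strict_total_order xi -> strict_total_order (fun x y => xi y x).
Proof.
move=> [irr tr tot]; split=> //; first by move=> y x z yx zy; apply: tr zy yx.
by move=> x y neq; rewrite orbC tot.
Qed.

(** Take [m] in [P] with the fewest predecessors. If some [z] in [P] preceded [m], its predecessors
    would be, by transitivity, a proper subset of those of [m]. *)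
Lemma first_element xi (P : pred A) x : strict_total_order xi -> P x ->
  exists2 m, P m & forall z, P z -> preceq xi m z.
Proof.
move=> [irr tr tot] Px.
case: (arg_minnP (fun z => #|[set w | xi w z]|) Px) => m Pm mmin.
exists m => // z Pz; rewrite /preceq; case: eqVneq => //= neq.
have /orP[//|zm] := tot _ _ neq.
have := mmin z Pz; rewrite leqNgt => /negP[]; apply: proper_card.
apply/properP; split; first by apply/fintype.subsetP => w; rewrite !inE => /tr; apply.
by exists z; rewrite inE ?irr.
Qed.

Lemma last_element xi (P : pred A) x : strict_total_order xi -> P x ->
  exists2 m, P m & forall z, P z -> preceq xi z m.
Proof.
move=> /strict_total_order_converse sto Px.
have [m Pm mmax] := first_element sto Px.
by exists m => // z /mmax; rewrite /preceq eq_sym.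
Qed.

Lemma preceq_xi_trans xi : strict_total_order xi ->
  forall x y z, preceq xi x y -> xi y z -> xi x z.
Proof. by move=> [_ tr _] x y z /orP[/eqP->//|]; apply: tr. Qed.

Lemma xi_preceq_trans xi : strict_total_order xi ->
  forall x y z, xi x y -> preceq xi y z -> xi x z.
Proof. by move=> [_ tr _] x y z xy /orP[/eqP<-//|]; apply: tr. Qed.

Lemma isucc_ex xi x y : strict_total_order xi -> xi x y ->
  exists x', isucc xi x x'.
Proof.
move=> sto xy; have [m xm mmin] := first_element (P := xi x) sto xy.
exists m; rewrite /isucc xm; apply/forallP => z; apply/negP => /andP[xz zm].
have := preceq_xi_trans sto (mmin _ xz) zm.
by case: sto => ->.
Qed.

Lemma ipred_ex xi x y : strict_total_order xi -> xi x y ->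
  exists2 p, isucc xi p y & preceq xi x p.
Proof.
move=> sto xy; have [m my mmax] := last_element (P := xi^~ y) sto xy.
exists m; last exact: mmax.
rewrite /isucc my; apply/forallP => z; apply/negP => /andP[mz zy].
have := xi_preceq_trans sto mz (mmax _ zy).
by case: sto => ->.
Qed.

End StrictTotalOrder.

Section Scores.
Context {R : realType} {A : finType}.
Implicit Types (v tau : A -> A -> R) (xi : rel A) (x y z : A).
Local Open Scope classical_set_scope.

(** * Indirect scores and the sign of their margins *)

Lemma path_score_cons v x y p :
  path_score v x (y :: p) = Num.min (v x y) (path_score v y p).
Proof. by rewrite /path_score /= big_cons. Qed.

Lemma path_score_le1 v x p : path_score v x p <= 1.
Proof.
elim: p x => [|y p IH] x; first by rewrite /path_score big_nil.
by rewrite path_score_cons ge_min IH orbT.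
Qed.

Lemma is_path1 x y : x != y -> is_path x y [:: y].
Proof. by move=> neq; rewrite /is_path /= neq eqxx. Qed.

Lemma indirect_score_ge v x y : x != y ->
  Num.min (v x y) 1 <= indirect_score v x y.
Proof.
move=> neq; apply: ub_le_sup.
  by exists 1 => _ [p _ <-]; apply: path_score_le1.
exists [:: y]; first exact: is_path1.
by rewrite path_score_cons /path_score big_nil.
Qed.

Lemma indirect_score_le v x y (c : R) : x != y ->
  (forall p, is_path x y p -> path_score v x p <= c) ->
  indirect_score v x y <= c.
Proof.
move=> neq pc; apply: ge_sup.
  by exists (path_score v x [:: y]), [:: y] => //; apply: is_path1.
by move=> _ [p xyp <-]; apply: pc.
Qed.

(** The path must leave [S] somewhere, and the edge where it does bounds the minimum. *)
Lemma path_score_crossing_le v (S : {set A}) (c : R) x p :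
  (forall a b, a \in S -> b \notin S -> v a b <= c) ->
  x \in S -> last x p \notin S -> path_score v x p <= c.
Proof.
move=> vc; elim: p x => [|y p IH] x xS /=; first by rewrite xS.
move=> lastN; rewrite path_score_cons ge_min.
have [yS|yS] := boolP (y \in S); first by rewrite IH ?orbT.
by rewrite vc.
Qed.

Lemma mnu_gt0_crossing v (X : {set A}) x y : llull_matrix v ->
  (forall a b, a \in X -> b \notin X -> 1 / 2 < v a b) ->
  x \in X -> y \notin X -> 0 < mnu v x y.
Proof.
move=> hv hX xX yX; have neq : x != y by apply: contraNneq yX => <-.
rewrite subr_gt0; apply: (@le_lt_trans _ _ (1 / 2)).
  rewrite eq_sym in neq; apply: indirect_score_le => // p /and3P[_ _ /eqP pl].
  (* An edge from [a] outside [X] to [b] in [X] satisfies [v a b <= 1 - v b a < 1/2]. *)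
  apply: (@path_score_crossing_le _ (~: X)); rewrite ?pl ?inE ?negbK //.
  move=> a b; rewrite !inE negbK => aX bX.
  have ba : b != a by apply: contraNneq aX => <-.
  by have := hX _ _ bX aX; have [_] := hv _ _ ba; lra.
apply: lt_le_trans (indirect_score_ge v neq).
by rewrite lt_min hX //=; lra.
Qed.

(** * Projected margins and the intervals [gamma] *)

Lemma msigma_ge0 v xi x y : admissible v xi -> xi x y -> 0 <= msigma v xi x y.
Proof.
move=> [sto _ hat] xy; rewrite /msigma.
have mnu_ge0 a b : xi a b -> 0 <= mnu v a b by move=> /hat /andP[].
apply: le_bigmin => [|[p q] /= /andP[px yq]]; first exact: mnu_ge0.
exact: mnu_ge0 (xi_preceq_trans sto (preceq_xi_trans sto px xy) yq).
Qed.

(** Each [gamma] is a union of intervals taken from finitely many pairs, so summing over all pairs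
    gives one bound for all. Boundedness is what makes [sup] and [inf] compare with the elements. *)
Lemma gamma_bounded v xi tau : exists M : R,
  forall x y s, gamma v xi tau x y s -> - M <= s <= M.
Proof.
pose f a b := `|tau a b| + `|msigma v xi a b|.
exists (\sum_(ab : A * A) f ab.1 ab.2) => x y s [[p q] _ /= /andP[s1 s2]].
have fM : f p q <= \sum_(ab : A * A) f ab.1 ab.2.
  by rewrite (bigD1 (p, q)) //= lerDl sumr_ge0 // => i _; rewrite addr_ge0.
move: fM; rewrite {1}/f.
have := ler_norm (tau p q); have := ler_norm (msigma v xi p q).
have := ler_norm (- tau p q); have := ler_norm (- msigma v xi p q).
rewrite !normrN => *; apply/andP; split; lra.
Qed.

Lemma gamma_has_ubound v xi tau x y : has_ubound (gamma v xi tau x y).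
Proof.
by have [M hM] := gamma_bounded v xi tau; exists M => s /hM /andP[].
Qed.

Lemma gamma_has_lbound v xi tau x y : has_lbound (gamma v xi tau x y).
Proof.
by have [M hM] := gamma_bounded v xi tau; exists (- M) => s /hM /andP[].
Qed.

Lemma sup_gamma_ge v xi tau x y p q : admissible v xi -> isucc xi p q ->
  preceq xi x p -> xi p y ->
  (tau p q + msigma v xi p q) / 2 <= sup (gamma v xi tau x y).
Proof.
move=> adm pq xp py; apply: ub_le_sup; first exact: gamma_has_ubound.
(* A nonnegative margin is needed for the upper endpoint to lie in its own interval. *)
have m0 : 0 <= msigma v xi p q by apply: msigma_ge0 => //; case/andP: pq.
exists (p, q); first by rewrite /= pq xp py.
by apply/andP; split=> /=; lra.
Qed.

Lemma inf_gamma_le v xi tau x y p q : admissible v xi -> isucc xi p q ->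
  preceq xi x p -> xi p y ->
  inf (gamma v xi tau x y) <= (tau p q - msigma v xi p q) / 2.
Proof.
move=> adm pq xp py; apply: ge_inf; first exact: gamma_has_lbound.
have m0 : 0 <= msigma v xi p q by apply: msigma_ge0 => //; case/andP: pq.
exists (p, q); first by rewrite /= pq xp py.
by apply/andP; split=> /=; lra.
Qed.

Lemma gamma_neq0 v xi tau x y : admissible v xi -> xi x y ->
  gamma v xi tau x y !=set0.
Proof.
move=> adm xy; have [sto _ _] := adm; have [x' xx'] := isucc_ex sto xy.
have m0 : 0 <= msigma v xi x x' by apply: msigma_ge0 => //; case/andP: xx'.
(* The witness is the midpoint of the first interval of the union. *)
exists (tau x x' / 2), (x, x'); first by rewrite /= xx' xy /preceq eqxx.
by apply/andP; split=> /=; lra.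
Qed.

Lemma gamma_subset v xi tau x y z w : strict_total_order xi ->
  preceq xi x z -> preceq xi w y -> gamma v xi tau z w `<=` gamma v xi tau x y.
Proof.
move=> sto xz wy s [[p q] /= /and3P[pq zp pw] hs]; exists (p, q) => //=.
rewrite pq (xi_preceq_trans sto pw wy) andbT /=.
case/orP: zp => [/eqP<-//|zp].
by rewrite /preceq (preceq_xi_trans sto xz zp) orbT.
Qed.

(* The case [x > z > y] is where the monotonicity constraints on the turnovers
   are needed: they give [t_pz >= t_pq >= t_zq] for the neighbours [p], [q]
   of [z]. *)
Lemma projected_score_mono v xi tau x y z : admissible v xi ->
  feasible_turnovers v xi tau -> xi x y -> z != x -> z != y ->
  projected_score v xi tau y z <= projected_score v xi tau x z.
Proof.
move=> adm [tsym _ tmono] xy zx zy; have [sto _ _] := adm.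
have [irr tr tot] := sto; rewrite /projected_score.
have asym a b : xi a b -> xi b a = false.
  by move=> ab; apply/negP => /(tr _ _ _ ab); rewrite irr.
have [yz|zNy] := boolP (xi y z).
  rewrite (tr _ _ _ xy yz); apply: le_sup; first last.
  - by split; [apply: gamma_neq0 (tr _ _ _ xy yz)|apply: gamma_has_ubound].
  - exact: gamma_neq0.
  apply: subset_trans (@le_down _ _).
  by apply: gamma_subset => //; rewrite /preceq ?xy ?eqxx ?orbT.
have {zNy}zy' : xi z y by have := tot _ _ zy; rewrite (negbTE zNy) orbF.
have [xz|xNz] := boolP (xi x z).
  (* The intervals of [(p, z)] and [(z, q)] belong to the two unions; the lower end of the second
     does not exceed the upper end of the first. *)
  have [p pz xp] := ipred_ex sto xz; have [q zq] := isucc_ex sto zy'.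
  have [/andP[pz' _] /andP[zq' _]] := (pz, zq).
  have pq := tr _ _ _ pz' zq'.
  apply: le_trans (inf_gamma_le tau adm zq _ zy') _; first by rewrite /preceq eqxx.
  apply: le_trans _ (sup_gamma_ge tau adm pz xp pz').
  have mpz := msigma_ge0 adm pz'; have mzq := msigma_ge0 adm zq'.
  have nqp : q != p by rewrite eq_sym (xi_neq sto pq).
  have nqz : q != z by rewrite eq_sym (xi_neq sto zq').
  have := tmono _ _ _ pz nqp nqz.
  have := tmono _ _ _ zq (xi_neq sto pz') (xi_neq sto pq).
  rewrite (tsym _ _ nqp) (tsym _ _ nqz) => /andP[? _] /andP[? _]; lra.
(* Here [z] precedes both, the two scores are infima, and the larger set goes with [y]. *)
have zx' : xi z x by have := tot _ _ zx; rewrite (negbTE xNz) orbF.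
apply: lb_le_inf; first exact: gamma_neq0.
move=> s hs; apply: ge_inf; first exact: gamma_has_lbound.
by apply: gamma_subset hs => //; rewrite /preceq ?xy ?eqxx ?orbT.
Qed.

Lemma rank_rate_lt v xi tau x y : admissible v xi ->
  feasible_turnovers v xi tau -> xi x y ->
  projected_score v xi tau y x < projected_score v xi tau x y ->
  rank_rate v xi tau x < rank_rate v xi tau y.
Proof.
move=> adm feas xy lt; have [sto _ _] := adm; have neq := xi_neq sto xy.
(* Splitting off the mutual scores of [x] and [y], which are strictly ordered, leaves sums over the
   same [z], compared term by term. *)
rewrite /rank_rate ltrD2l ltrN2 (bigD1 x) //= [ltRHS](bigD1 y) 1?eq_sym //=.
apply: ltr_leD => //.
rewrite (eq_bigl (fun z => (z != x) && (z != y))); last by move=> z; rewrite andbC.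
by apply: ler_sum => z /andP[zx zy]; apply: projected_score_mono.
Qed.

(* The junction of [X] and its complement is the pair of consecutive elements
   whose [gamma] is not reduced to a point. *)
Lemma projected_score_lt_crossing v xi tau (X : {set A}) x y :
  admissible v xi ->
  (forall a b, a \in X -> b \notin X -> 0 < mnu v a b) ->
  x \in X -> y \notin X ->
  projected_score v xi tau y x < projected_score v xi tau x y.
Proof.
move=> adm hX xX yX; have [sto sub _] := adm; have [irr tr tot] := sto.
have xiX a b : a \in X -> b \notin X -> xi a b.
  move=> aX bX; apply: sub; rewrite /nu /= hX // andbT.
  by apply: contraNneq bX => <-.
have xy := xiX _ _ xX yX.
have Nyx : xi y x = false by apply/negP => /(tr _ _ _ xy); rewrite irr.
rewrite /projected_score xy Nyx.
have [a aX amax] := last_element (P := mem X) sto xX.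
have ay := xiX _ _ aX yX; have [b ab] := isucc_ex sto ay.
have /andP[ab' _] := ab.
have afterN c : xi a c -> c \notin X.
  by move=> ac; apply/negP => /amax /(xi_preceq_trans sto ac); rewrite irr.
have beforeX c : preceq xi c a -> c \in X.
  move=> ca; apply/negPn/negP => cX.
  by have := preceq_xi_trans sto ca (xiX _ _ aX cX); rewrite irr.
(* Each pair [(p, q)] in this minimum has [p] in [X] and [q] outside. *)
have m_gt0 : 0 < msigma v xi a b.
  apply: lt_bigmin => [|[p q] /= /andP[pa bq]]; first exact: hX (afterN _ ab').
  exact: hX (beforeX _ pa) (afterN _ (xi_preceq_trans sto ab' bq)).
(* The two scores are separated by the endpoints of the interval of [(a, b)]. *)
apply: le_lt_trans (inf_gamma_le tau adm ab (amax _ xX) ay) _.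
apply: lt_le_trans _ (sup_gamma_ge tau adm ab (amax _ xX) ay).
lra.
Qed.

End Scores.

Theorem corollary15p2 (R : realType) (A : finType) (v : A -> A -> R)
    (X Y : {set A})
    (hv : llull_matrix v)
    (hXYcover : X :|: Y = [set: A]) (hXYdisj : [disjoint X & Y])
    (hXY : forall x y : A, x \in X -> y \in Y -> 1 / 2 < v x y)
    (xi : rel A) (hxi : admissible v xi)
    (tsigma : A -> A -> R) (ht : projected_turnovers v xi tsigma)
    (x y : A) (hx : x \in X) (hy : y \in Y) :
  rank_rate v xi tsigma x < rank_rate v xi tsigma y.
Proof.
have yX : y \notin X by rewrite (disjointFl hXYdisj hy).
have hX a b : a \in X -> b \notin X -> 0 < mnu v a b.
  apply: mnu_gt0_crossing hv _ => {a b} a b aX bX; apply: hXY => //.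
  by have := finset.in_setT b; rewrite -hXYcover inE (negbTE bX).
have [_ sub _] := hxi.
apply: rank_rate_lt => //; first by case: ht.
  by apply: sub; rewrite /nu /= hX // andbT; apply: contraNneq yX => <-.
exact: projected_score_lt_crossing hX hx yX.
Qed.
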